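(* Suppose that for some stationary $S \subseteq \Lambda$, where $\Lambda\subseteq\omega_1$ is the set of limit ordinals, some ladder system $(L_\alpha : \alpha \in S)$ has the uniformization property. Then there is a complete theory $T$ in a language of size $\aleph_1$ such that $T$ has a unique (up to isomorphism) atomic model, which is additionally prime, yet which is not constructible.
   Context: A ladder system on a stationary $S \subseteq \Lambda$ is a sequence $(L_\alpha : \alpha \in S)$ such that for each $\alpha \in S$, $L_\alpha \subset \alpha$ is cofinal in $\alpha$ and of order type $\omega$. It has the uniformization property if for every sequence $(f_\alpha : \alpha \in S)$ of functions $f_\alpha : L_\alpha \to 2$ there is some $f : \omega_1 \to 2$ such that for all $\alpha \in S$, $\{\beta \in L_\alpha : f_\alpha(\beta) \neq f(\beta)\}$ is finite. A model $M$ is atomic if every finite tuple from $M$ has its type over $\emptyset$ isolated by a single formula; $M$ is prime if for every $N \equiv M$ there is an elementary embedding of $M$ into $N$; $M$ is constructible if it can be enumerated as a sequence $M = (a_\alpha : \alpha < \alpha^* )$ such that each $tp(a_\alpha/\{a_\beta : \beta < \alpha\})$ is isolated by a single formula. *)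

(* Defs.v *)
From mathcomp Require Import all_boot all_order.
From mathcomp Require Import boolp classical_sets functions cardinality wochoice.

Set Implicit Arguments.
Unset Strict Implicit.
Unset Printing Implicit Defensive.

Import Order.TTheory.
Local Open Scope classical_set_scope.
Local Open Scope order_scope.

(* omega_1 is determined up to isomorphism by this property. *)
Definition is_omega1 d (W : orderType d) : Prop :=
  [/\ well_order (<=%O : rel W), ~ countable [set: W]
    & forall a : W, countable [set b | b < a]].

Section Ladders.
Context {d : Order.disp_t} {W : orderType d}.
Implicit Types (S C : set W) (L : W -> set W).

(* The least element is not counted as a limit. *)
Definition limit_ordinals : set W :=
  [set a | (exists b, b < a) /\ forall b, b < a -> exists2 c, b < c & c < a].

Definition club C : Prop :=
  (forall a, exists2 c, C c & a < c) /\
  (forall a, limit_ordinals a ->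
     (forall b, b < a -> exists2 c, C c & b < c < a) -> C a).

Definition stationary S : Prop := forall C, club C -> S `&` C !=set0.

Definition order_type_omega (A : set W) : Prop :=
  exists2 e : nat -> W, {homo e : m n / (m < n)%N >-> m < n} & range e = A.

(* The values of L outside S are irrelevant. *)
Definition ladder_system S L : Prop :=
  forall a, S a ->
    [/\ L a `<=` [set b | b < a],
        forall b, b < a -> exists2 c, L a c & b <= c
      & order_type_omega (L a)].

(* A family of colourings (f_a : L a -> 2) indexed by S is given by a total
   function of which only the values f a b with S a and L a b matter. *)
Definition uniformizable S L : Prop :=
  forall f : W -> W -> bool, exists g : W -> bool,
    forall a, S a -> finite_set [set b | L a b /\ f a b <> g b].

End Ladders.

Record language := Language {
  fun_sym : Type; fun_arity : fun_sym -> nat;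
  rel_sym : Type; rel_arity : rel_sym -> nat }.

(* Formulas have their free variables in a type V; a quantifier binds the
   extra variable None of option V. *)
Inductive term (L : language) (V : Type) : Type :=
| tvar of V
| tfun (f : fun_sym L) of ('I_(fun_arity f) -> term L V).

Inductive formula (L : language) (V : Type) : Type :=
| fbot
| feq of term L V & term L V
| fatom (r : rel_sym L) of ('I_(rel_arity r) -> term L V)
| fimp of formula L V & formula L V
| fall of formula L (option V).

Arguments fbot {L V}.

Definition fneg L V (p : formula L V) : formula L V := fimp p fbot.

Record structure (L : language) := Structure {
  carrier :> Type;
  carrier_inhabited : inhabited carrier;
  fun_int : forall f : fun_sym L, ('I_(fun_arity f) -> carrier) -> carrier;
  rel_int : forall r : rel_sym L, ('I_(rel_arity r) -> carrier) -> Prop }.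

Fixpoint eval L (M : structure L) V (v : V -> M) (t : term L V) : M :=
  match t with
  | tvar x => v x
  | tfun f ts => fun_int (fun i => eval v (ts i))
  end.

Fixpoint sat L (M : structure L) V (v : V -> M) (p : formula L V) : Prop :=
  match p with
  | fbot => False
  | feq s t => eval v s = eval v t
  | fatom r ts => rel_int (fun i => eval v (ts i))
  | fimp p q => sat v p -> sat v q
  | fall p => forall x : M, sat (oapp v x) p
  end.

Definition sentence L := formula L void.

Definition holds L (M : structure L) (p : sentence L) : Prop :=
  sat (@of_void M) p.

Definition models L (M : structure L) (T : set (sentence L)) : Prop :=
  forall p, T p -> holds M p.

Definition entails L (T : set (sentence L)) (p : sentence L) : Prop :=
  forall M : structure L, models M T -> holds M p.

Definition complete_theory L (T : set (sentence L)) : Prop :=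
  (exists M : structure L, models M T) /\
  forall p, entails T p \/ entails T (fneg p).

Definition elementarily_equivalent L (M N : structure L) : Prop :=
  forall p : sentence L, holds M p <-> holds N p.

Definition elementary_embedding L (M N : structure L) (h : M -> N) : Prop :=
  forall n (p : formula L 'I_n) (a : 'I_n -> M), sat a p <-> sat (h \o a) p.

Definition isomorphic L (M N : structure L) : Prop :=
  exists h : M -> N,
    [/\ bijective h,
        forall (f : fun_sym L) a, h (fun_int (f := f) a) = fun_int (f := f) (h \o a)
      & forall (r : rel_sym L) a, rel_int (r := r) a <-> rel_int (r := r) (h \o a)].

Section Types.
Variables (L : language) (M : structure L).

(* A formula in n variables with parameters from A is a formula whose free
   variables are the n variables together with the elements of A, the latter
   standing for themselves. *)
Definition with_params n (A : set M) (a : 'I_n -> M) (x : 'I_n + A) : M :=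
  match x with inl i => a i | inr c => \val c end.

Definition tp n (A : set M) (a : 'I_n -> M) : set (formula L ('I_n + A)) :=
  [set p | sat (with_params a) p].
Arguments tp {n} A a.

(* Isolation is modulo the complete theory of M with names for A, and so can
   be evaluated in M. *)
Definition isolated n (A : set M) (a : 'I_n -> M) : Prop :=
  exists2 p, tp A a p &
    forall q, tp A a q ->
      forall b : 'I_n -> M, sat (with_params b) p -> sat (with_params b) q.

Definition atomic : Prop := forall n (a : 'I_n -> M), isolated set0 a.

Definition prime_model : Prop :=
  forall N : structure L, elementarily_equivalent N M ->
    exists h : M -> N, elementary_embedding h.

(* The ordinal alpha^* is an arbitrary well-ordered index type. *)
Definition constructible : Prop :=
  exists (d : Order.disp_t) (I : orderType d) (e : I -> M),
    [/\ well_order (<=%O : rel I), range e = [set: M]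
      & forall i : I,
          isolated (e @` [set j | j < i]) (fun _ : 'I_1 => e i)].

End Types.

(* Main.v *)
Require Import Defs.
From mathcomp Require Import all_boot all_order.
From mathcomp Require Import boolp classical_sets functions cardinality wochoice.

Local Open Scope classical_set_scope.
Local Open Scope card_scope.

Set Implicit Arguments.
Unset Strict Implicit.
Unset Printing Implicit Defensive.

Import Order.TTheory.

(** For each ladder [L_j], [j \in S], take a sort consisting of the functions
    [L_j -> 2] that are eventually zero. The language can say of two points
    that they lie in the sort [j] ([Sort j]), that they are both defined and
    equal at the ordinal [c] ([Agree c]), and that they lie in one sort and
    coincide from the [n]-th rung of its ladder on ([Tail n]). The theory [T] is
    the complete theory of this structure [M].

    _Automorphisms and atomicity._ A map [s : I -> bool] that is finitely
    supported on every ladder flips the coordinates of all points at once, and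
    is an automorphism ([sat_flip]). Two ladders meet in a finite set, and two
    points of one sort differ at finitely many coordinates, so finitely many
    instances of the three relations determine how two points lie with respect
    to each other. Two tuples with the same finite diagram differ by a flip
    ([diagram_flip]); hence diagrams isolate types and [M] is atomic.

    _Uniqueness and primeness._ A model [N] of [T] still colours each coordinate
    with two colours, but neither of them is distinguished. Name them 0 and 1
    arbitrarily; then a point [q_j] in each sort of [N] gives a colouring of each
    ladder. A uniformizing [g] tells which names to exchange so that every [q_j]
    becomes eventually zero, and then the points of [N] at finite distance from the [q_j] form a
    copy of [M] ([ladder_embedding]). The embedding is elementary since it
    preserves diagrams. If [N] is atomic, then it satisfies the disjunction of
    the [Sort j], and [Sort j] implies the disjunction of the [Tail n]
    ([atomic_transfer]); so the copy is all of [N].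

    _Non-constructibility._ In a construction of [M], let [q_j] be the first
    point of sort [j]. A formula isolating its type over its predecessors has
    finitely many parameters, all in other sorts, so flipping a rung of [L_j]
    outside finitely many fixes these parameters; thus some rung [r j] of [L_j]
    is not a coordinate of any predecessor of [q_j]
    ([isolated_new_coordinate]). Of two sorts, the one that is reached later
    shows that their values of [r] differ. So [r] is an injective regressive
    function on a stationary set, which is absurd. *)

(** * Bounds on sets of natural numbers *)

Lemma finite_nat_bound (A : set nat) :
  finite_set A <-> exists N, forall n, A n -> (n < N)%N.
Proof.
split=> [fA|[N AN]]; last by apply: sub_finite_set (finite_II N) => n /AN.
have /finite_seqP[s ->] := fA.
exists (\max_(n <- s) n).+1 => n /= ns; rewrite ltnS.
by rewrite (big_rem n) //= leq_maxl.
Qed.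

Lemma injective_avoids T (f : nat -> T) c : injective f ->
  exists N, forall n, (N <= n)%N -> f n <> c.
Proof.
move=> f_inj; case: (pselect (exists n, f n = c)) => [[k <-]|nE].
  by exists k.+1 => n /gtn_eqF kn /f_inj nk; rewrite nk eqxx in kn.
by exists 0 => n _ E; apply: nE; exists n.
Qed.

Lemma uniform_bound (T : finType) (P : T -> nat -> Prop) :
  (forall i, exists N, forall n, (N <= n)%N -> P i n) ->
  exists N, forall i n, (N <= n)%N -> P i n.
Proof.
move=> /(@choice T nat)[N hN]; exists (\max_i N i) => i n Nn.
by apply: hN; apply: leq_trans Nn; exact: leq_bigmax.
Qed.

(** * Formulas: connectives, renaming and finite support *)

Section Connectives.
Variable L : language.

Definition fand V (p q : formula L V) := fneg (fimp p (fneg q)).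
Definition fex V (p : formula L (option V)) := fneg (fall (fneg p)).
Definition fconj V (T : finType) (F : T -> formula L V) :=
  foldr (fun t => fand (F t)) (fneg fbot) (enum T).
Definition flit V (b : bool) (p : formula L V) := if b then p else fneg p.

Variable (M : structure L).

Lemma sat_fand V (v : V -> M) p q : sat v (fand p q) <-> sat v p /\ sat v q.
Proof.
split=> [/= /not_notP h|[? ?] /= h]; last by tauto.
by split; apply: contrapT; tauto.
Qed.

Lemma sat_fex V (v : V -> M) p :
  sat v (fex p) <-> exists x, sat (oapp v x) p.
Proof.
split=> [/= h|[x px] /= h]; last exact: (h x).
by apply: contrapT => nex; apply: h => x px; apply: nex; exists x.
Qed.

Lemma sat_fconj V (v : V -> M) (T : finType) (F : T -> formula L V) :
  sat v (fconj F) <-> forall t, sat v (F t).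
Proof.
rewrite /fconj; split=> [h t|h].
  have: t \in enum T by rewrite mem_enum.
  elim: (enum T) h => //= u s IH /sat_fand[Fu Fs]; rewrite inE.
  by case/predU1P=> [->//|]; exact: IH.
by elim: (enum T) => [|u s IH]; [move=> /= | apply/sat_fand].
Qed.

Lemma sat_flit V (v : V -> M) (P : Prop) p :
  sat v (flit `[< P >] p) <-> (P <-> sat v p).
Proof. by rewrite /flit; case: asboolP => /= hP; tauto. Qed.

End Connectives.

Section Renaming.
Variable L : language.

Fixpoint term_map V W (k : V -> W) (t : term L V) : term L W :=
  match t with
  | tvar x => tvar L (k x)
  | tfun f ts => tfun (fun i => term_map k (ts i))
  end.

Fixpoint rename V W (k : V -> W) (p : formula L V) : formula L W :=
  match p with
  | fbot => fbot
  | feq s t => feq (term_map k s) (term_map k t)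
  | fatom r ts => fatom (fun i => term_map k (ts i))
  | fimp p q => fimp (rename k p) (rename k q)
  | fall p => fall (rename (omap k) p)
  end.

Variable M : structure L.

Lemma eval_term_map V W (k : V -> W) (v : W -> M) t :
  eval v (term_map k t) = eval (v \o k) t.
Proof. by elim: t => //= f ts IH; congr fun_int; apply/funext. Qed.

Lemma sat_rename V W (k : V -> W) (v : W -> M) p :
  sat v (rename k p) <-> sat (v \o k) p.
Proof.
elim: p W k v => {V} [V|V s t|V r ts|V p IHp q IHq|V p IH] W k v //=.
- by rewrite !eval_term_map.
- by under eq_fun do rewrite eval_term_map.
- by split=> h /IHp /h /IHq.
- have E x : oapp v x \o omap k = oapp (v \o k) x by apply/funext=> -[].
  by split=> h x; have := IH _ (omap k) (oapp v x); rewrite E => {}IH; apply/IH.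
Qed.

Lemma eval_finite_support V (t : term L V) :
  exists2 F : set V, finite_set F &
    forall v w : V -> M, (forall x, F x -> v x = w x) -> eval v t = eval w t.
Proof.
elim: t => [x|f ts IH]; first by exists [set x] => // v w /(_ x erefl).
have [G GP] := choice (fun i =>
    let: ex_intro2 F fF FP := IH i in ex_intro _ F (conj fF FP)).
exists (\bigcup_i G i); first by apply: bigcup_finite => // i _; case: (GP i).
move=> v w h /=; congr fun_int; apply/funext=> i.
by apply: (GP i).2 => x Gx; apply: h; exists i.
Qed.

(** In a type over a set of parameters, the parameters are variables: this says
    that a formula depends on finitely many of them. *)
Lemma sat_finite_support V (p : formula L V) :
  exists2 F : set V, finite_set F &
    forall v w : V -> M, (forall x, F x -> v x = w x) -> sat v p -> sat w p.
Proof.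
elim: p => {V} [V|V s t|V r ts|V p [F fF Fp] q [G fG Gq]|V p [F fF Fp]].
- by exists set0.
- have [F fF Fs] := eval_finite_support s; have [G fG Gt] := eval_finite_support t.
  exists (F `|` G); first by rewrite finite_setU.
  move=> v w h /=; rewrite (Fs v w) => [|x ?]; last by apply: h; left.
  by rewrite (Gt v w) => // x ?; apply: h; right.
- have [G GP] := choice (fun i =>
    let: ex_intro2 F fF FP := eval_finite_support (ts i) in
    ex_intro _ F (conj fF FP)).
  exists (\bigcup_i G i); first by apply: bigcup_finite => // i _; case: (GP i).
  move=> v w h /=; congr rel_int; apply/funext=> i.
  by apply: (GP i).2 => x Gx; apply: h; exists i.
- exists (F `|` G); first by rewrite finite_setU.
  move=> v w h /= pq wp; apply: (Gq v) => [x ?|]; first by apply: h; right.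
  by apply: pq; apply: (Fp w) => // x ?; rewrite h//; left.
- exists (Some @^-1` F); first by apply: finite_preimage => // x y _ _ [].
  move=> v w h /= vp x; apply: (Fp (oapp v x)) (vp x) => -[y|] Fy //=.
  exact: h.
Qed.

End Renaming.

(** * Transfer between elementarily equivalent structures *)

Section Transfer.
Variable L : language.

Definition ord0_void (i : 'I_0) : void := False_rect void (notF (ltn_ord i)).

Fixpoint closure n : formula L 'I_n -> sentence L :=
  match n with
  | 0 => fun p => rename ord0_void p
  | n.+1 => fun p => closure (fall (rename (unlift ord_max) p))
  end.

Lemma holds_closure n (p : formula L 'I_n) (M : structure L) :
  holds M (closure p) <-> forall a : 'I_n -> M, sat a p.
Proof.
elim: n p => [|n IH] p.
  split=> [/sat_rename h a|h]; last by apply/sat_rename; apply: h.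
  by rewrite (_ : a = @of_void M \o ord0_void) //; apply/funext; case.
rewrite /= IH /=; split=> h a.
  move: (h (a \o lift ord_max) (a ord_max)) => /sat_rename.
  congr sat; apply/funext => i /=.
  by case: unliftP => [j|] ->.
move=> x; apply/sat_rename; exact: h.
Qed.

Variables M N : structure L.
Hypothesis NM : elementarily_equivalent N M.

Lemma transfer (V : finType) (p : formula L V) :
  (forall a : V -> M, sat a p) -> forall b : V -> N, sat b p.
Proof.
pose q := rename (@enum_rank V) p.
move=> hM; have : holds N (closure q).
  by apply/NM/holds_closure => a; apply/sat_rename/hM.
move/holds_closure => h b; move: (h (b \o enum_val)) => /sat_rename.
by congr sat; apply/funext => x /=; rewrite enum_rankK.
Qed.

End Transfer.

Section AtomicTransfer.
Variables (L : language) (M N : structure L).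
Hypothesis NM : elementarily_equivalent N M.

(** An infinite disjunction that holds throughout [M] passes to the atomic
    models of its theory: the formula isolating the type of [b] is realized in
    [M], by a tuple satisfying some [P k]; as it decides [P k], it implies it. *)
Lemma atomic_transfer (aN : atomic N) n K (P : K -> formula L 'I_n) :
  (forall a : 'I_n -> M, exists k, sat a (P k)) ->
  forall b : 'I_n -> N, exists k, sat b (P k).
Proof.
move=> hM b; have [p pb iso] := aN n b.
pose k0 (x : 'I_n + (set0 : set N)) : 'I_n :=
  match x with inl i => i | inr c => False_rect _ (set_mem (valP c)) end.
pose q := rename k0 p.
have qE (c : 'I_n -> N) : sat c q <-> sat (with_params c) p.
  rewrite sat_rename; suff -> : c \o k0 = with_params c by [].
  by apply/funext => -[i//|[x hx]]; case: (set_mem hx).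
have [a qa] : exists a : 'I_n -> M, sat a q.
  apply: contrapT => na; apply: (@transfer _ _ _ NM _ (fneg q) _ b).
    by move=> a /= qa; apply: na; exists a.
  exact/qE.
have [k Pka] := hM a; exists k; apply: contrapT => nPb.
have MN : elementarily_equivalent M N by move=> s; rewrite NM.
apply: (@transfer _ _ _ MN _ (fimp q (fneg (P k))) _ a qa Pka) => c /qE pc.
have := iso (rename inl (fneg (P k))) _ c pc.
rewrite /tp /mkset !sat_rename; exact.
Qed.

End AtomicTransfer.

Section Isomorphisms.
Variables (L : language) (M N : structure L) (h : M -> N).
Hypothesis hbij : bijective h.
Hypothesis hf : forall (f : fun_sym L) a,
  h (fun_int (f := f) a) = fun_int (f := f) (h \o a).
Hypothesis hr : forall (r : rel_sym L) a,
  rel_int (r := r) a <-> rel_int (r := r) (h \o a).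

Lemma eval_isomorphism V (v : V -> M) t : eval (h \o v) t = h (eval v t).
Proof. by elim: t => //= f ts IH; rewrite hf; congr fun_int; apply/funext. Qed.

Lemma sat_isomorphism V (v : V -> M) p : sat v p <-> sat (h \o v) p.
Proof.
have [g hK gK] := hbij.
elim: p v => {V} [V|V s t|V r ts|V p IHp q IHq|V p IH] v //=.
- by rewrite !eval_isomorphism; split=> [->//|/(bij_inj hbij)].
- by rewrite hr; under [X in _ <-> rel_int X]eq_fun do rewrite eval_isomorphism.
- by split=> pq /IHp /pq /IHq.
- have E x : h \o oapp v x = oapp (h \o v) (h x) by apply/funext=> -[].
  split=> vp x; last by apply/IH; rewrite E.
  by rewrite -[x]gK -E -IH.
Qed.

End Isomorphisms.

Definition theory (L : language) (M : structure L) : set (sentence L) :=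
  [set p | holds M p].

Lemma theory_complete (L : language) (M : structure L) : complete_theory (theory M).
Proof.
split; first by exists M.
move=> p; case: (pselect (holds M p)) => Mp; [left|right] => N; exact.
Qed.

Lemma models_theory (L : language) (M N : structure L) :
  models N (theory M) -> elementarily_equivalent N M.
Proof.
move=> NM p; split=> [Np|]; last exact: NM.
by apply: contrapT => nMp; exact: (NM (fneg p) nMp).
Qed.

(** * The structure of a ladder system *)

Lemma addb_iff (a b c d : bool) : (a = b <-> c = d) -> c (+) a = d (+) b.
Proof. by case: a; case: b; case: c; case: d; intuition. Qed.

Section LadderStructure.
(** [J] indexes the sorts, and [e j] enumerates the coordinates of the sort [j].
    The order of the ordinals enters only in the enumeration, so that [I] and [J]
    are plain types here. *)
Variables I J : Type.

Inductive ladder_symbol := Sort of J | Agree of I | Tail of nat.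

(** All symbols are binary, so that the diagram of a tuple is read off from its
    pairs; [Sort j] relates any two points of the sort [j]. *)
Definition ladder_language : language :=
  @Language void (of_void nat) ladder_symbol (fun=> 2).
Local Notation Lg := ladder_language.

Definition two T (x y : T) (i : 'I_2) : T := if i == ord0 then x else y.

Lemma two_eta T (a : 'I_2 -> T) : a = two (a ord0) (a ord_max).
Proof.
apply/funext => -[[|[|k]] lti] //; rewrite /two /=; congr a; exact: val_inj.
Qed.

Lemma comp_two T U (h : T -> U) x y : h \o two x y = two (h x) (h y).
Proof. by apply/funext => i; rewrite /= /two; case: ifP. Qed.

Definition rel2 (N : structure Lg) (r : ladder_symbol) (u v : N) : Prop :=
  @rel_int Lg N r (two u v).

Definition atom V (r : ladder_symbol) (x y : V) : formula Lg V :=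
  @fatom Lg V r (two (tvar Lg x) (tvar Lg y)).

Lemma sat_atom (N : structure Lg) V (v : V -> N) r x y :
  sat v (atom r x y) = rel2 r (v x) (v y).
Proof.
rewrite /= /rel2; congr (@rel_int Lg N r _); apply/funext => i /=.
by rewrite /two; case: ifP.
Qed.

Variable e : J -> nat -> I.
Hypothesis e_inj : forall j, injective (e j).
Hypothesis e_disjoint : forall j k, j <> k ->
  exists N, forall n m, (N <= n)%N -> e j n <> e k m.
Hypothesis J_inh : inhabited J.

Record point := Point {
  psort : J;
  pval : nat -> bool;
  pval_fin : exists N, forall n, (N <= n)%N -> pval n = false }.

Lemma point_eq x y : psort x = psort y -> pval x =1 pval y -> x = y.
Proof.
case: x y => [j f fj] [k g gk] /= jk /funext fg; subst.
by congr Point; apply: Prop_irrelevance.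
Qed.

(** Points of different sorts may index the common ordinal [c] differently: hence
    the two rungs [m] and [n]. *)
Definition prel (r : ladder_symbol) (x y : point) : Prop :=
  match r with
  | Sort j => psort x = j /\ psort y = j
  | Agree c => exists m n,
      [/\ e (psort x) m = c, e (psort y) n = c & pval x m = pval y n]
  | Tail n => psort x = psort y /\ forall m, (n <= m)%N -> pval x m = pval y m
  end.

Lemma fin_false : exists N, forall n, (N <= n)%N -> (fun=> false) n = false.
Proof. by exists 0. Qed.

Lemma point_inh : inhabited point.
Proof. by case: J_inh => j; exact: (inhabits (Point j fin_false)). Qed.

Definition ladder_structure : structure Lg :=
  @Structure Lg point point_inh
    (fun f => of_void _ f) (fun r a => prel r (a ord0) (a ord_max)).
Local Notation M := ladder_structure.

(** * Flips are automorphisms *)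

Definition finitary (s : I -> bool) :=
  forall j, exists N, forall n, (N <= n)%N -> s (e j n) = false.

Lemma flip_fin s (fs : finitary s) (x : point) :
  exists N, forall n, (N <= n)%N -> pval x n (+) s (e (psort x) n) = false.
Proof.
have [N hN] := pval_fin x; have [K hK] := fs (psort x).
by exists (maxn N K) => n; rewrite geq_max => /andP[/hN-> /hK->].
Qed.

Definition flip s (fs : finitary s) (x : point) : point :=
  Point (psort x) (flip_fin fs x).

Lemma flipK s (fs : finitary s) : involutive (flip fs).
Proof. by move=> x; apply: point_eq => //= n; rewrite addbK. Qed.

Lemma flip_rel s (fs : finitary s) r x y :
  prel r x y <-> prel r (flip fs x) (flip fs y).
Proof.
case: r => [j|c|n] //=.
  by split=> -[m [n [xm yn E]]]; exists m, n; split=> //;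
    move: E; rewrite xm yn; [move=> ->|move/addIb].
split=> -[xy E]; split=> // m /E; rewrite xy; first by move=> ->.
by move/addIb.
Qed.

Lemma sat_flip s (fs : finitary s) V (v : V -> M) p :
  sat v p <-> sat (flip fs \o v : V -> M) p.
Proof.
apply: (@sat_isomorphism _ M M (flip fs)) => [|[]|r a].
  by exists (flip fs); exact: flipK.
exact: flip_rel.
Qed.

(** * Diagrams isolate types *)

Lemma level_ex (x y : point) : exists N, forall n, (N <= n)%N ->
  (psort x = psort y -> pval x n = pval y n) /\
  (psort x <> psort y -> forall m, e (psort x) n <> e (psort y) m).
Proof.
case: (pselect (psort x = psort y)) => [xy|/[dup] xy /e_disjoint[N hN]].
  have [N hN] := pval_fin x; have [K hK] := pval_fin y.
  by exists (maxn N K) => n; rewrite geq_max => /andP[/hN-> /hK->].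
by exists N => n Nn; split=> // _ m; exact: hN.
Qed.

(** From this rung on, the relation between [x] and [y] is forced: in one sort
    they coincide, in different sorts they have no common coordinate. *)
Definition level x y := projT1 (cid (level_ex x y)).

Lemma level_same x y n :
  psort x = psort y -> (level x y <= n)%N -> pval x n = pval y n.
Proof. by move=> xy; rewrite /level; case: cid => N /= hN /hN[/(_ xy)]. Qed.

Lemma level_diff x y n m :
  e (psort x) n = e (psort y) m -> (level x y <= n)%N -> psort x = psort y.
Proof.
move=> xy; rewrite /level; case: cid => N /= hN /hN[_ h].
by apply: contrapT => /h/(_ m).
Qed.

(** The symbols that determine the relation between two points of level [N], the
    first of which has sort [j]. *)
Definition test j N k : ladder_symbol :=
  match k with 0 => Sort j | 1 => Tail N | k.+2 => Agree (e j k) end.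

Definition diagram (T : finType) (a : T -> M) : formula Lg T :=
  fconj (fun i => fconj (fun j => fconj (fun k : 'I_(level (a i) (a j)).+2 =>
    let r := test (psort (a i)) (level (a i) (a j)) k in
    flit `[< prel r (a i) (a j) >] (atom r i j)))).

Lemma sat_diagram (N : structure Lg) (T : finType) (a : T -> M) (b : T -> N) :
  sat b (diagram a) <->
  forall i j k, (k < (level (a i) (a j)).+2)%N ->
    let r := test (psort (a i)) (level (a i) (a j)) k in
    prel r (a i) (a j) <-> rel2 r (b i) (b j).
Proof.
rewrite sat_fconj; split=> [h i j k ltk|h i].
  move: (h i) => /sat_fconj /(_ j) /sat_fconj /(_ (Ordinal ltk)) /sat_flit.
  by rewrite sat_atom.
apply/sat_fconj => j; apply/sat_fconj => k; apply/sat_flit.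
by rewrite sat_atom; exact: h.
Qed.

(** The flip is read off from the coordinates of the [a i] and [b i]. Where two
    sorts share a coordinate, the diagram ensures that both prescribe the same
    value: below the level by [Agree], above it, where the sorts must be equal, by
    [Tail]. *)
Lemma diagram_flip (T : finType) (a b : T -> M) :
  sat b (diagram a) -> exists s (fs : finitary s), b = flip fs \o a.
Proof.
move/sat_diagram => h.
have sb i : psort (b i) = psort (a i).
  by have /= [/(_ (conj erefl erefl))[]] := h i i 0 isT.
have coh i j n m : e (psort (a i)) n = e (psort (a j)) m ->
    (pval (b i) n (+) pval (a i) n) = (pval (b j) m (+) pval (a j) m).
  move=> nm; have [ltn|leN] := ltnP n (level (a i) (a j)).
    have /= := h i j n.+2 ltn; rewrite !sb => -[h1 h2].
    have E (x y : point) : pval x n = pval y m <-> exists k l,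
        [/\ e (psort (a i)) k = e (psort (a i)) n,
            e (psort (a j)) l = e (psort (a i)) n & pval x k = pval y l].
      split=> [xy|[k [l [/e_inj-> ln]]]]; first by exists n, m.
      by rewrite nm in ln; rewrite (e_inj ln).
    by apply: addb_iff; rewrite !E.
  have ij := level_diff nm leN; rewrite -ij in nm; rewrite -(e_inj nm).
  have /= [/(_ (conj ij (fun _ => level_same ij)))[_ /(_ n leN)->]] := h i j 1 isT.
  by rewrite (level_same ij leN).
pose s c := `[< exists i n,
  e (psort (a i)) n = c /\ pval (b i) n (+) pval (a i) n >].
have sE i n : s (e (psort (a i)) n) = pval (b i) n (+) pval (a i) n.
  apply/asboolP/idP => [[k [m [E]]]|bi]; first by rewrite (coh _ _ _ _ E).
  by exists i, n.
have fs : finitary s.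
  move=> j.
  have [N hN] : exists N, forall i n, (N <= n)%N ->
      pval (b i) n (+) pval (a i) n = false.
    apply: uniform_bound => i; have [N hN] := pval_fin (a i).
    have [K hK] := pval_fin (b i).
    by exists (maxn N K) => n; rewrite geq_max => /andP[/hN-> /hK->].
  have [K hK] : exists K, forall (im : T * 'I_N) n, (K <= n)%N ->
      e j n <> e (psort (a im.1)) im.2.
    by apply: uniform_bound => im; exact: injective_avoids.
  exists K => n Kn; apply/negbTE/asboolPn => -[i [m [E d]]].
  have [mN|/(hN i)] := ltnP m N; last by rewrite d.
  exact: (hK (i, Ordinal mN) n Kn (esym E)).
exists s, fs; apply/funext => i; apply: point_eq => //= n.
by rewrite sE addbC addbK.
Qed.

Lemma ladder_atomic : atomic M.
Proof.
move=> n a; exists (rename inl (diagram a)).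
  by apply/sat_rename/sat_diagram.
move=> q qa b /sat_rename/diagram_flip[s [fs bE]].
have -> : with_params b = flip fs \o with_params (A := set0) a.
  apply/funext => -[i|[x hx]]; last by case: (set_mem hx).
  exact: (congr1 (fun c => c i) bE).
exact: (sat_flip fs _ q).1 qa.
Qed.

(** A diagram implies in [M], hence in [N], every formula that its tuple
    satisfies. *)
Lemma diagram_transfer (N : structure Lg) (NM : elementarily_equivalent N M)
  (T : finType) (a : T -> M) (b : T -> N) :
  sat b (diagram a) -> forall p : formula Lg T, sat a p <-> sat b p.
Proof.
have key p : sat b (diagram a) -> sat a p -> sat b p.
  move=> ba ap; apply: (transfer NM (p := fimp (diagram a) p)) ba => c /=.
  by move=> /diagram_flip[s [fs ->]]; exact: (sat_flip fs _ p).1 ap.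
move=> ba p; split; first exact: key.
by move=> bp; apply: contrapT => nap; exact: (key (fneg p) ba nap bp).
Qed.

Arguments rel2 : simpl never.

Definition three T (u v w : T) (i : 'I_3) : T :=
  match nat_of_ord i with 0 => u | 1 => v | _ => w end.

(** * Models of the theory of the structure *)

Section Embedding.
Variable N : structure Lg.
Hypothesis NM : elementarily_equivalent N M.
Hypothesis uniform : forall f : J -> nat -> bool, exists g : I -> bool,
  forall j, exists K, forall n, (K <= n)%N -> f j n = g (e j n).

(** Every finite pattern of relations in [N] occurs in [M]: universal properties
    of the relations carry over from [M] to [N] by an inspection of points of
    [M]. *)
Lemma realize_pattern (T : finType) (b : T -> N) (F : seq ladder_symbol) :
  exists a : T -> M, (forall i j, a i = a j <-> b i = b j) /\
    forall i j k, (k < size F)%N ->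
      prel (nth (Tail 0) F k) (a i) (a j) <-> rel2 (nth (Tail 0) F k) (b i) (b j).
Proof.
pose p : formula Lg T := fconj (fun i => fconj (fun j =>
  fand (flit `[< b i = b j >] (feq (tvar Lg i) (tvar Lg j)))
    (fconj (fun k : 'I_(size F) => flit `[< rel2 (nth (Tail 0) F k) (b i) (b j) >]
       (atom (nth (Tail 0) F k) i j))))).
have pE (R : structure Lg) (c : T -> R) : sat c p <->
    (forall i j, b i = b j <-> c i = c j) /\
    forall i j k, (k < size F)%N ->
      rel2 (nth (Tail 0) F k) (b i) (b j) <-> rel2 (nth (Tail 0) F k) (c i) (c j).
  split=> [/sat_fconj h|[h1 h2]].
    split=> [i j|i j k ltk]; have /sat_fconj/(_ j)/sat_fand[h1 h2] := h i.
      by have /sat_flit := h1.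
    by have /sat_fconj/(_ (Ordinal ltk))/sat_flit := h2; rewrite sat_atom.
  apply/sat_fconj => i; apply/sat_fconj => j; apply/sat_fand; split.
    exact/sat_flit.
  by apply/sat_fconj => k; apply/sat_flit; rewrite sat_atom; exact: h2.
apply: contrapT => na; have : sat b p by apply/pE.
apply: (transfer NM (p := fneg p)) => c /= /pE[h1 h2]; apply: na; exists c.
by split=> [i j|i j k /h2 h]; [rewrite h1|exact: iff_sym (h i j)].
Qed.

(* The variables of universal properties of at most three points. *)
Local Notation x0 := (@Ordinal 3 0 isT).
Local Notation x1 := (@Ordinal 3 1 isT).
Local Notation x2 := (@Ordinal 3 2 isT).

Implicit Types u v w : N.

Let in_sort j (u : N) := rel2 (Sort j) u u.

Lemma rel_sort j u v : rel2 (Sort j) u v <-> in_sort j u /\ in_sort j v.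
Proof.
have [a [_ aR]] := realize_pattern (three u v v) [:: Sort j].
have := (aR x0 x1 0 isT, aR x0 x0 0 isT, aR x1 x1 0 isT).
by rewrite /in_sort /three /=; tauto.
Qed.

Lemma sort_uniq j k u : in_sort j u -> in_sort k u -> j = k.
Proof.
have [a [_ aR]] := realize_pattern (three u u u) [:: Sort j; Sort k].
have := (aR x0 x0 0 isT, aR x0 x0 1 isT); rewrite /in_sort /three /=.
by move=> [<- <-] [<- _] [<- _].
Qed.

Lemma agree_sym c u v : rel2 (Agree c) u v -> rel2 (Agree c) v u.
Proof.
have [a [_ aR]] := realize_pattern (three u v v) [:: Agree c].
have := (aR x0 x1 0 isT, aR x1 x0 0 isT); rewrite /three /= => -[<- <-].
by move=> [m [n [? ? ?]]]; exists n, m.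
Qed.

Lemma agree_refl c u v : rel2 (Agree c) u v -> rel2 (Agree c) u u.
Proof.
have [a [_ aR]] := realize_pattern (three u v v) [:: Agree c].
have := (aR x0 x1 0 isT, aR x0 x0 0 isT); rewrite /three /= => -[<- <-].
by move=> [m [n [? ? ?]]]; exists m, m.
Qed.

Lemma agree_trans c u v w :
  rel2 (Agree c) u v -> rel2 (Agree c) v w -> rel2 (Agree c) u w.
Proof.
have [a [_ aR]] := realize_pattern (three u v w) [:: Agree c].
have := (aR x0 x1 0 isT, aR x1 x2 0 isT, aR x0 x2 0 isT).
rewrite /three /= => -[[<- <-] <-].
move=> [m [n [mc nc E]]] [n' [k [nc' kc E']]]; exists m, k; split=> //.
by rewrite E -E' (e_inj (etrans nc (esym nc'))).
Qed.

Lemma agree_two c u v w : rel2 (Agree c) u u -> rel2 (Agree c) v v ->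
  rel2 (Agree c) w w -> ~ rel2 (Agree c) u w -> ~ rel2 (Agree c) v w ->
  rel2 (Agree c) u v.
Proof.
have [a [_ aR]] := realize_pattern (three u v w) [:: Agree c].
have := (aR x0 x0 0 isT, aR x1 x1 0 isT, aR x2 x2 0 isT, aR x0 x2 0 isT,
  aR x1 x2 0 isT, aR x0 x1 0 isT).
rewrite /three /= => -[[[[[<- <-] <-] <-] <-] <-].
move=> [m [_ [mc _ _]]] [n [_ [nc _ _]]] [k [_ [kc _ _]]] mk nk.
exists m, n; split=> //; apply: contrapT => mn.
have {}mk : pval (a x0) m <> pval (a x2) k by move=> E; apply: mk; exists m, k.
have {}nk : pval (a x1) n <> pval (a x2) k by move=> E; apply: nk; exists n, k.
by move: mk nk mn; do 3 case: pval.
Qed.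

Lemma sort_agree j c u : in_sort j u ->
  rel2 (Agree c) u u <-> exists n, e j n = c.
Proof.
have [a [_ aR]] := realize_pattern (three u u u) [:: Sort j; Agree c].
have := (aR x0 x0 0 isT, aR x0 x0 1 isT); rewrite /in_sort /three /= => -[<- <-].
move=> [<- _]; split=> [[n [_ [? _ _]]]|[n nc]]; first by exists n.
by exists n, n.
Qed.

Lemma tail_sym n u v : rel2 (Tail n) u v -> rel2 (Tail n) v u.
Proof.
have [a [_ aR]] := realize_pattern (three u v v) [:: Tail n].
have := (aR x0 x1 0 isT, aR x1 x0 0 isT); rewrite /three /= => -[<- <-].
by move=> [-> E]; split=> // m /E.
Qed.

Lemma tail_trans n u v w :
  rel2 (Tail n) u v -> rel2 (Tail n) v w -> rel2 (Tail n) u w.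
Proof.
have [a [_ aR]] := realize_pattern (three u v w) [:: Tail n].
have := (aR x0 x1 0 isT, aR x1 x2 0 isT, aR x0 x2 0 isT).
rewrite /three /= => -[[<- <-] <-].
by move=> [-> E] [-> F]; split=> // m nm; rewrite E ?F.
Qed.

Lemma tail_sort n j u v : rel2 (Tail n) u v -> in_sort j u -> in_sort j v.
Proof.
have [a [_ aR]] := realize_pattern (three u v v) [:: Tail n; Sort j].
have := (aR x0 x1 0 isT, aR x0 x0 1 isT, aR x1 x1 1 isT).
by rewrite /in_sort /three /= => -[[<- <-] <-] [-> _].
Qed.

Lemma tail0 u v : rel2 (Tail 0) u v -> u = v.
Proof.
have [a [aE aR]] := realize_pattern (three u v v) [:: Tail 0].
have := (aR x0 x1 0 isT, aE x0 x1); rewrite /three /= => -[<- <-].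
by move=> [? E]; apply: point_eq => // n; exact: E.
Qed.

Lemma tailS n j u v : in_sort j u -> in_sort j v ->
  rel2 (Tail n) u v <-> rel2 (Agree (e j n)) u v /\ rel2 (Tail n.+1) u v.
Proof.
have [a [_ aR]] := realize_pattern (three u v v)
  [:: Sort j; Tail n; Tail n.+1; Agree (e j n)].
have := (aR x0 x0 0 isT, aR x1 x1 0 isT, aR x0 x1 1 isT, aR x0 x1 2 isT,
  aR x0 x1 3 isT).
rewrite /in_sort /three /= => -[[[[<- <-] <-] <-] <-] [uj _] [vj _]; rewrite uj vj.
split=> [[_ E]|[[m [k [/e_inj -> /e_inj -> E]]] [_ F]]]; split=> //.
- by exists n, n; split=> //; exact: E.
- by split=> // m /ltnW/E.
- by move=> i; rewrite leq_eqVlt => /predU1P[<-|/F].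
Qed.

Lemma sort_nonempty j : exists u, in_sort j u.
Proof.
pose p : formula Lg void := fex (atom (Sort j) None None).
have : sat (@of_void N) p.
  apply: (transfer NM (p := p)) => a; apply/sat_fex.
  by exists (Point j fin_false); rewrite sat_atom.
by move=> /sat_fex[u]; rewrite sat_atom; exists u.
Qed.

(** Apart from [sort_nonempty], this is the only existential axiom of the theory
    that the embedding below needs; all others are universal. *)
Lemma prescribe_coordinates j u K (d : nat -> bool) : in_sort j u ->
  exists v, [/\ in_sort j v, rel2 (Tail K) u v &
    forall n, (n < K)%N -> rel2 (Agree (e j n)) u v <-> d n].
Proof.
pose q : formula Lg unit := fex (fand (atom (Sort j) None None)
  (fand (atom (Tail K) (Some tt) None)
    (fconj (fun n : 'I_K => flit (d n) (atom (Agree (e j n)) (Some tt) None))))).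
have Mq (a : unit -> M) : psort (a tt) = j -> sat a q.
  move=> aj.
  have fin : exists N, forall n, (N <= n)%N ->
      (if (n < K)%N then pval (a tt) n (+) ~~ d n else pval (a tt) n) = false.
    have [L hL] := pval_fin (a tt); exists (maxn K L) => n.
    by rewrite geq_max => /andP[Kn /hL->]; rewrite ltnNge Kn.
  apply/sat_fex; exists (Point (psort (a tt)) fin); apply/sat_fand.
  split; first by rewrite sat_atom.
  apply/sat_fand; split.
    by rewrite sat_atom; split=> //= m Km; rewrite ltnNge Km.
  apply/sat_fconj => n; rewrite -[d n]asboolb; apply/sat_flit.
  rewrite sat_atom; split=> [dn|[m [k [/=]]]].
    by exists n, n; rewrite /= aj ltn_ord dn addbF.
  rewrite aj => /e_inj-> /e_inj->; rewrite ltn_ord.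
  by case: pval; case: (d n).
move=> uj; have /sat_fex[v] : sat (fun=> u) q.
  apply: (transfer NM (p := fimp (atom (Sort j) tt tt) q)).
    move=> a h; apply: Mq; move: h.
    by rewrite -/(sat a (atom _ _ _)) sat_atom => -[].
  by rewrite -/(sat _ (atom _ _ _)) sat_atom.
move=> /sat_fand[]; rewrite sat_atom => vj /sat_fand[]; rewrite sat_atom => uv.
move=> /sat_fconj h; exists v; split=> // n ltn.
have := h (Ordinal ltn); rewrite -[d n]asboolb => /sat_flit.
by rewrite sat_atom asboolb => E; split; move/E.
Qed.

(** [Agree c] has at most two classes, so a point [r c] that has the coordinate
    [c] splits the others into those that agree with it and those that do not. *)
Lemma colouring : exists col : I -> N -> bool, forall c u v,
  rel2 (Agree c) u u -> rel2 (Agree c) v v ->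
  rel2 (Agree c) u v <-> col c u = col c v.
Proof.
have /choice[r rP] : forall c, exists r, forall u,
    rel2 (Agree c) u u -> rel2 (N := N) (Agree c) r r.
  move=> c.
  case: (pselect (exists u, rel2 (N := N) (Agree c) u u)) => [[r rr]|no].
    by exists r.
  by have [r] := carrier_inhabited N; exists r => u uu; case: no; exists u.
exists (fun c u => `[< rel2 (Agree c) u (r c) >]) => c u v uu vv; split=> [uv|E].
  by apply/asbool_equiv_eq; split; apply: agree_trans => //; exact: agree_sym.
have {}E : rel2 (Agree c) u (r c) <-> rel2 (Agree c) v (r c).
  exact: asbool_eq_equiv.
case: (pselect (rel2 (Agree c) u (r c))) => [ur|nur].
  exact: agree_trans ur (agree_sym (E.1 ur)).
by apply: (agree_two uu vv (rP _ _ uu) nur); rewrite -E.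
Qed.

(** The only use of uniformization: after exchanging the two colours of the
    coordinates [c] with [g c], the chosen points [q j] are eventually zero. *)
Lemma coordinates : exists (val : J -> N -> nat -> bool) (q : J -> N), [/\
  forall j, in_sort j (q j),
  forall j, exists K, forall n, (K <= n)%N -> val j (q j) n = false
  & forall j k u v m n, in_sort j u -> in_sort k v -> e j m = e k n ->
      rel2 (Agree (e j m)) u v <-> val j u m = val k v n].
Proof.
have [col colP] := colouring.
have [q qP] := choice sort_nonempty.
have [g gP] := uniform (fun j n => col (e j n) (q j)).
exists (fun j u n => col (e j n) u (+) g (e j n)), q; split=> //.
  by move=> j; have [K hK] := gP j; exists K => n /hK->; rewrite addbb.
move=> j k u v m n uj vk mn.
rewrite colP; [|by apply/(sort_agree _ uj); exists m
               |by apply/(sort_agree _ vk); exists n].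
by rewrite mn; split=> [->|/addIb].
Qed.

(** A point of [M] goes to the point of [N] that has the same coordinates and lies
    at finite distance from [q j]. *)
Lemma ladder_embedding : exists h : M -> N,
  (forall r x y, rel2 r x y <-> rel2 r (h x) (h y)) /\
  (atomic N -> forall u, exists x, h x = u).
Proof.
have [val [q [qj qfin valP]]] := coordinates.
have valE j u v n : in_sort j u -> in_sort j v ->
    rel2 (Agree (e j n)) u v <-> val j u n = val j v n.
  by move=> uj vj; exact: valP.
have tail_val j n u v : in_sort j u -> in_sort j v -> rel2 (Tail n) u v ->
    forall m, (n <= m)%N -> rel2 (Tail m) u v /\ val j u m = val j v m.
  move=> uj vj uv m /subnK<-; elim: (m - n)%N => [|k [IH _]].
    rewrite add0n; split=> //; apply/(valE _ _ _ _ uj vj).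
    by case/(tailS _ uj vj): uv.
  have {IH}/(tailS _ uj vj)[_ IH] := IH.
  by rewrite addSn; split=> //; apply/(valE _ _ _ _ uj vj); case/(tailS _ uj vj): IH.
(* Points at finite distance are related by [Tail n] as soon as they coincide
     from [n] on: go down from a common tail one rung at a time. *)
have val_tail j n K u v : in_sort j u -> in_sort j v -> rel2 (Tail K) u v ->
    (forall m, (n <= m)%N -> val j u m = val j v m) -> rel2 (Tail n) u v.
  move=> uj vj uv E.
  have [+ _] := tail_val _ _ _ _ uj vj uv _ (leq_addl n K).
  elim: K {uv} => [|K IH]; first by rewrite addn0.
  rewrite addnS => nK; apply: IH; apply/(tailS _ uj vj); split=> //.
  by apply/(valE _ _ _ _ uj vj)/E; exact: leq_addr.
have /choice[h hP] : forall x : point, exists u, [/\ in_sort (psort x) u,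
    exists K, rel2 (Tail K) (q (psort x)) u & val (psort x) u =1 pval x].
  move=> x; set j := psort x.
  have [K0 hK0] := qfin j; have [K1 hK1] := pval_fin x.
  have [v [vj qv vP]] := prescribe_coordinates (maxn K0 K1)
    (fun n => val j (q j) n == pval x n) (qj j).
  exists v; split=> //; first by exists (maxn K0 K1).
  move=> n; have [ltn|len] := ltnP n (maxn K0 K1).
    have := vP n ltn; rewrite (valE _ _ _ _ (qj j) vj).
    move=> E; have := addb_iff (iff_trans E (iff_sym (rwP eqP))).
    by rewrite addbb; case: (val j v n); case: (pval x n).
  have [_ <-] := tail_val _ _ _ _ (qj j) vj qv n len.
  by move: len; rewrite geq_max => /andP[/hK0-> /hK1->].
have hj x : in_sort (psort x) (h x) by case: (hP x).
have hv x n : val (psort x) (h x) n = pval x n by case: (hP x).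
have hK x : exists K, rel2 (Tail K) (q (psort x)) (h x) by case: (hP x).
have common_tail j u v : in_sort j u -> in_sort j v ->
    (exists K, rel2 (Tail K) (q j) u) ->
    (exists K, rel2 (Tail K) (q j) v) -> exists K, rel2 (Tail K) u v.
  move=> uj vj [K qu] [L qv]; exists (maxn K L).
  have [] := tail_val _ _ _ _ (qj j) uj qu _ (leq_maxl K L).
  have [] := tail_val _ _ _ _ (qj j) vj qv _ (leq_maxr K L).
  by move=> {}qv _ {}qu _; apply: tail_trans qv; exact: tail_sym.
exists h; split=> [r x y|aN u].
  case: r => [k|c|n].
  - rewrite rel_sort; split=> [[<- yx]|[xk yk]]; first by split=> //; rewrite -yx.
    by split; [exact: sort_uniq xk|exact: sort_uniq yk].
  - split=> [[m [n [mc nc E]]]|xy].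
      have mn := etrans mc (esym nc).
      by rewrite -mc; apply/(valP _ _ _ _ _ _ (hj x) (hj y) mn); rewrite !hv.
    have /(sort_agree _ (hj x))[m mc] := agree_refl xy.
    have /(sort_agree _ (hj y))[n nc] := agree_refl (agree_sym xy).
    exists m, n; split=> //; rewrite -!hv.
    by apply/(valP _ _ _ _ _ _ (hj x) (hj y) (etrans mc (esym nc))); rewrite mc.
  split=> [[xy E]|xy].
    have yj := hj y; rewrite -xy in yj.
    have [|K xyK] := common_tail _ _ _ (hj x) yj (hK x); first by rewrite xy.
    apply: val_tail (hj x) yj xyK _ => m /E; rewrite -!hv => ->; by rewrite xy.
  have xyj := sort_uniq (tail_sort xy (hj x)) (hj y); split=> // m nm.
  have yj := hj y; rewrite -xyj in yj.
  have [_] := tail_val _ _ _ _ (hj x) yj xy _ nm.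
  by rewrite -!hv => ->; rewrite -xyj.
(* Atomicity puts [u] into some sort, at finite distance from its [q j]. *)
have [j uj] : exists j, in_sort j u.
  have := @atomic_transfer _ M N NM aN 1 J (fun j => atom (Sort j) ord0 ord0).
  case/(_ _ (fun=> u)) => [a|j].
    by exists (psort (a ord0)); rewrite sat_atom.
  by rewrite sat_atom; exists j.
have [K qu] : exists K, rel2 (Tail K) (q j) u.
  have := @atomic_transfer _ M N NM aN 2 nat
    (fun n => fimp (atom (Sort j) ord0 ord_max) (atom (Tail n) ord0 ord_max)).
  case/(_ _ (two (q j) u)) => [a|K].
    have [K hK'] := level_ex (a ord0) (a ord_max); exists K.
    rewrite /sat -!/(sat a (atom _ _ _)) !sat_atom => -[a0 a1].
    have E : psort (a ord0) = psort (a ord_max) by rewrite a0.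
    by split=> // m /hK'[/(_ E)].
  rewrite /sat -!/(sat _ (atom _ _ _)) !sat_atom => h'; exists K; apply: h'.
  exact/rel_sort.
have fin : exists L, forall n, (L <= n)%N -> val j u n = false.
  have [L hL] := qfin j; exists (maxn K L) => n.
  rewrite geq_max => /andP[Kn /hL].
  by have [_ ->] := tail_val _ _ _ _ (qj j) uj qu _ Kn.
exists (Point j fin); set x := Point j fin; have xj : in_sort j (h x) := hj x.
have [|K' xu] := common_tail _ _ _ xj uj (hK x); first by exists K.
by apply/tail0/(val_tail _ _ _ _ _ xj uj xu) => m _; rewrite (hv x).
Qed.

Lemma ladder_elementary_embedding : exists h : M -> N, elementary_embedding h.
Proof.
have [h [hr _]] := ladder_embedding; exists h => n p a.
suff ha : sat (h \o a) (diagram a) by exact: (diagram_transfer NM ha p).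
apply/sat_diagram => i j k ltk.
exact: hr.
Qed.

Lemma ladder_isomorphic : atomic N -> isomorphic N M.
Proof.
move=> aN; have [h [hr /(_ aN)/choice[g hg]]] := ladder_embedding.
have h_inj : injective h.
  move=> x y xy; have : rel2 (Tail 0) x y by apply/hr; rewrite xy; apply/hr.
  by move=> [? E]; apply: point_eq => // n; exact: E.
have gh : cancel h g by move=> x; apply: h_inj; rewrite hg.
exists g; split=> [|[]|r a]; first by exists h.
rewrite (two_eta a) comp_two; apply: (iff_trans _ (iff_sym (hr r _ _))).
by rewrite !hg.
Qed.

End Embedding.

(** * The structure is not constructible *)

Lemma flip_at_finitary (c : I) : finitary (fun c' => `[< c' = c >]).
Proof.
move=> j; have [N hN] := injective_avoids c (@e_inj j).
by exists N => n /hN nc; exact/asboolPn.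
Qed.

(** If the type of [q] over [A] is isolated by [p], flip a coordinate of [q] that
    is not a coordinate of the finitely many parameters of [p]. The flipped [q]
    satisfies [p], so it agrees with the same points of [A] as [q] at this
    coordinate; hence there are no points of [A] to compare with. *)
Lemma isolated_new_coordinate (A : set M) (q : M) :
  (forall x, A x -> psort x <> psort q) -> isolated A (fun _ : 'I_1 => q) ->
  exists n, forall x, A x -> forall m, e (psort x) m <> e (psort q) n.
Proof.
move=> Aq [p pq p_iso]; have [F fF Fp] := sat_finite_support M p.
pose B (v : 'I_1 + A) : set nat := [set n | exists2 x : A,
  v = inr x & exists m, e (psort q) n = e (psort (\val x)) m].
have [N BN] : exists N, forall n, (\bigcup_(v in F) B v) n -> (n < N)%N.
  apply/finite_nat_bound/bigcup_finite => // -[i|x] _; apply/finite_nat_bound.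
    by exists 0 => n [].
  have xq : psort q <> psort (\val x).
    by apply/nesym/Aq; exact: set_mem (valP x).
  have [N hN] := e_disjoint xq; exists N => n [_ [<-] [m E]].
  by rewrite ltnNge; apply/negP => Nn; exact: (hN n m Nn E).
exists N => x Ax m xm.
have fix_param y : F (inr y) ->
    flip (flip_at_finitary (e (psort q) N)) (\val y) = \val y.
  move=> Fy; apply: point_eq => //= n; case: asboolP => [yn|]; last by rewrite addbF.
  have : (N < N)%N by apply: BN; exists (inr y) => //; exists y => //; exists n.
  by rewrite ltnn.
set s := flip_at_finitary _ in fix_param.
have pb : sat (with_params (A := A) (fun _ : 'I_1 => flip s q : M)) p.
  apply: (Fp (flip s \o with_params (A := A) (fun=> q))) => [[i|y] Fy //=|].
    exact: fix_param.
  exact: (sat_flip s _ p).1 pq.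
pose x' : A := exist _ x (mem_set Ax).
pose r := atom (Agree (e (psort q) N)) (inl ord0 : 'I_1 + A) (inr x').
have rE (u : M) : psort u = psort q ->
    sat (with_params (A := A) (fun _ : 'I_1 => u)) r <-> pval u N = pval x m.
  move=> uq; rewrite sat_atom /=; split=> [[k [l [/=]]]|E].
    by rewrite uq => /e_inj->; rewrite -xm => /e_inj->.
  by exists N, m; rewrite /= uq.
have : sat (with_params (A := A) (fun _ : 'I_1 => flip s q : M))
    (flit (pval q N == pval x m) r).
  apply: p_iso pb; rewrite /tp /mkset /flit; case: eqP => E; first exact/rE.
  by move/rE => /(_ erefl).
rewrite /flit; have H := rE (flip s q) erefl.
case: eqP => E; first by move/H => /=; rewrite asboolT // E addbT; case: pval.
move/H; apply; rewrite /= asboolT // addbT.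
by move: E; case: pval; case: pval.
Qed.

(** The coordinate [e j (h j)] first occurs in the construction together with the
    first point of sort [j], which recovers [j]. *)
Lemma constructible_injection : constructible M ->
  exists h : J -> nat, injective (fun j => e j (h j)).
Proof.
move=> [d [D [en [wo rng iso]]]].
have least j : exists i, psort (en i) = j /\
    forall i', (i' < i)%O -> psort (en i') <> j.
  have [i [[/asboolP ij imin] _]] :
      exists! i, minimum_of <=%O [pred i | `[< psort (en i) = j >]] i.
    apply: wo; have [i _ iE] : range en (Point j fin_false) by rewrite rng.
    by exists i; apply/asboolP; rewrite iE.
  exists i; split=> // i' ltii' /asboolP i'j.
  by have := imin i' i'j; rewrite /= leNgt ltii'.
have [f fP] := choice least.
have new j : exists n, forall i, (i < f j)%O ->
    forall m, e (psort (en i)) m <> e j n.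
  have [fj fmin] := fP j.
  have [|n hn] := isolated_new_coordinate _ (iso (f j)).
    by move=> _ [i /= /fmin ij <-]; rewrite fj.
  by exists n => i lti m; rewrite -[j]fj; apply: hn; exists i.
have [h hP] := choice new; exists h => j k jk.
have [fj _] := fP j; have [fk _] := fP k.
have [/hP|/hP|E] := ltgtP (f j) (f k); last by rewrite -fj -fk E.
  by move/(_ (h j)); rewrite fj jk.
by move/(_ (h k)); rewrite fk jk.
Qed.

End LadderStructure.

(** * Stationary sets and cardinality of omega_1 *)

Section Omega1.
Context {d : Order.disp_t} {W : orderType d}.
Hypothesis hW : is_omega1 W.

Lemma least_element (P : W -> Prop) : (exists a, P a) ->
  exists2 a, P a & forall b, P b -> (a <= b)%O.
Proof.
move=> [a Pa]; have [wo _ _] := hW.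
have [|b [[/asboolP Pb bmin] _]] := wo [pred b | `[< P b >]].
  by exists a; exact/asboolP.
by exists b => // c Pc; apply: bmin; exact/asboolP.
Qed.

Lemma omega1_wf : well_founded (fun a b : W => (a < b)%O).
Proof.
move=> a; apply: contrapT => na.
have [b nb bmin] := @least_element
  (fun a => ~ Acc (fun a b => (a < b)%O) a) (ex_intro _ a na).
apply: nb; constructor => c cb; apply: contrapT => /bmin.
by rewrite leNgt cb.
Qed.

Lemma countable_strict_bound (A : set W) : countable A ->
  exists b, forall a, A a -> (a < b)%O.
Proof.
move=> cA; apply: contrapT => nb; have [_ + cW] := hW; apply.
have -> : [set: W] = A `|` \bigcup_(a in A) [set b | (b < a)%O].
  apply/seteqP; split=> // b _; have : ~ forall a, A a -> (a < b)%O.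
    by move=> hb; apply: nb; exists b.
  move=> /existsNP[a /not_implyP[Aa /negP]]; rewrite -leNgt le_eqVlt.
  by case/predU1P => [->|ba]; [left|right; exists a].
rewrite -bigcup2E; apply: bigcup_countable => // -[|[|i]] _ //=.
exact: bigcup_countable.
Qed.

(** This case of Fodor's lemma has a direct proof: by injectivity, only countably
    many [a] have [r a] below a given point, so the points closed under passing
    from [r a] to [a] form a club; at a point of this club, [r] is not
    regressive. *)
Lemma no_injective_regression (S : set W) (r : W -> W) : stationary S ->
  (forall a, S a -> (r a < a)%O) ->
  (forall a b, S a -> S b -> r a = r b -> a = b) -> False.
Proof.
move=> stS r_lt r_inj.
pose C : set W := [set c | forall a, S a -> (r a < c)%O -> (a < c)%O].
have [_ _ cW] := hW.
have /choice[nxt nxtP] : forall c, exists c', (c < c')%O /\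
    forall a, S a -> (r a < c)%O -> (a < c')%O.
  move=> c.
  have [|b hb] := @countable_strict_bound (c |` [set a | S a /\ (r a < c)%O]).
    rewrite -bigcup2E; apply: bigcup_countable => // -[|[|i]] _ //=.
    have /countable_injP[f f_inj] := cW c; apply/countable_injP; exists (f \o r).
    move=> a b /set_mem[Sa ra] /set_mem[Sb rb] /f_inj E.
    by apply: r_inj => //; apply: E; exact/mem_set.
  by exists b; split=> [|a Sa ra]; apply: hb; [left|right].
suff [delta [Sd Cd]] : S `&` C !=set0 by have := Cd _ Sd (r_lt _ Sd); rewrite ltxx.
apply: stS; split=> [a|a [_ _] lim b Sb rba]; last first.
  have [c Cc /andP[rbc ca]] := lim _ rba.
  exact: lt_trans (Cc _ Sb rbc) ca.
(* The supremum of the iterates of [nxt] from [a] is in [C]. *)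
pose g n := iter n nxt a.
have [|b0 hb0] := @countable_strict_bound (range g).
  exact: card_le_trans (card_image_le _ _) _.
have [c cg cmin] := @least_element (fun c => forall n, (g n < c)%O)
  (ex_intro _ b0 (fun n => hb0 _ (imageT g n))).
exists c; last exact: (cg 0).
move=> b Sb rbc; have [n rbn] : exists n, (r b < g n)%O.
  apply: contrapT => nn; suff /cmin : forall n, (g n < r b)%O by rewrite leNgt rbc.
  move=> n; apply: (lt_le_trans (nxtP (g n)).1).
  by rewrite leNgt; apply/negP => ?; apply: nn; exists n.+1.
exact: lt_trans ((nxtP _).2 _ Sb rbn) (cg n.+1).
Qed.

Lemma countable_recursion (R : W -> W -> Prop) :
  (forall A : set W, countable A -> exists c, forall a, A a -> R a c) ->
  exists h : W -> W, forall a b, (b < a)%O -> R (h b) (h a).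
Proof.
move=> RP; have [_ _ cW] := hW.
have step (a : W) : forall F : (forall b : W, (b < a)%O -> W), exists c,
    forall b (ba : (b < a)%O), R (F b ba) c.
  move=> F; pose G b := if pselect (b < a)%O is left ba then F b ba else a.
  have [|c cP] := RP (G @` [set b | (b < a)%O]).
    exact: card_le_trans (card_image_le _ _) (cW a).
  exists c => b ba; have := cP (G b) (imageP G ba).
  by rewrite /G; case: pselect => // ba'; rewrite (Prop_irrelevance ba' ba).
pose next a F := projT1 (cid (step a F)).
exists (Fix omega1_wf (fun=> W) next) => a b ba; rewrite [X in R _ X]Fix_eq.
  by rewrite /next; case: cid => c /= /(_ b ba).
move=> c F G FG; congr next.
by apply: functional_extensionality_dep => y; apply/funext.
Qed.

(** The pair [(a, n)] goes to the [n]-th element of a block of order type omega;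
    the blocks are placed one above the other by recursion. *)
Lemma nat_prod_injection : exists f : W * nat -> W, injective f.
Proof.
have /choice[nxt nxtP] : forall c : W, exists c', (c < c')%O.
  move=> c; have [b hb] := @countable_strict_bound [set c] (countable1 c).
  by exists b; exact: hb.
have [A cA|h hP] := @countable_recursion
    (fun a c => forall n, (iter n nxt a < c)%O).
  have [|b hb] := @countable_strict_bound (\bigcup_n (iter n nxt @` A)).
    apply: bigcup_countable => // n _.
    exact: card_le_trans (card_image_le _ _) cA.
  by exists b => a Aa n; apply: hb; exists n => //; exists a.
have iter_ge n c : (c <= iter n nxt c)%O.
  by elim: n => //= n IH; exact: le_trans IH (ltW (nxtP _)).
have iter_mono c m n : (m < n)%N -> (iter m nxt c < iter n nxt c)%O.
  elim: n => // n IH; rewrite ltnS leq_eqVlt => /predU1P[->|/IH mn].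
    exact: nxtP.
  exact: lt_trans mn (nxtP _).
have block a b m n : (a < b)%O -> (iter m nxt (h a) < iter n nxt (h b))%O.
  by move=> /hP/(_ m) ab; exact: lt_le_trans ab (iter_ge _ _).
exists (fun x => iter x.2 nxt (h x.1)) => -[a m] [b n] /= E.
have [ab|ba|ab] := ltgtP a b.
- by have := block a b m n ab; rewrite E ltxx.
- by have := block b a n m ba; rewrite E ltxx.
rewrite -ab in E *; have [mn|nm|->//] := ltngtP m n.
- by have := iter_mono (h a) m n mn; rewrite E ltxx.
- by have := iter_mono (h a) n m nm; rewrite E ltxx.
Qed.

End Omega1.

Lemma injective_card_le T U (f : T -> U) : injective f -> [set: T] #<= [set: U].
Proof.
move=> f_inj; have : f @` [set: T] #= [set: T].
  by apply: inj_card_eq => x y _ _; exact: f_inj.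
rewrite card_eq_le => /andP[_ Tf]; apply: card_le_trans Tf _.
exact: subset_card_le.
Qed.

Lemma ladder_symbols_card d (W : orderType d) (hW : is_omega1 W) (S : set W) :
  [set: fun_sym (ladder_language W S) + rel_sym (ladder_language W S)] #= [set: W].
Proof.
have [f f_inj] := nat_prod_injection hW.
have [w _] := countable_strict_bound hW (@countable0 W).
rewrite card_eq_le; apply/andP; split; last first.
  apply: (@injective_card_le _ _ (fun c => inr (@Agree W S c) : void + _)).
  by move=> x y [].
pose code (s : void + ladder_symbol W S) : W * nat :=
  match s with
  | inl v => of_void _ v
  | inr (Sort j) => (\val j, 0)
  | inr (Agree c) => (c, 1)
  | inr (Tail n) => (w, n.+2)
  end.
apply: (@injective_card_le _ _ (f \o code)); apply: inj_comp => //.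
move=> [[]|[j|c|n]] [[]|[j'|c'|n']] //= [].
- by move/val_inj->.
- by move->.
- by move->.
Qed.

(** * The ladder system and the theorem *)

Section LadderEnumeration.
Context {d : Order.disp_t} {W : orderType d}.
Variables (S : set W) (L : W -> set W).
Hypotheses (ladL : ladder_system S L) (unifL : uniformizable S L).

(** Ladders [j < k] meet in a finite set: from some rung on, [L_k] is above [j],
    hence above all of [L_j]. *)
Lemma ladder_enumeration : exists e : S -> nat -> W,
  [/\ forall j, injective (e j),
      forall j k, j <> k -> exists N, forall n m, (N <= n)%N -> e j n <> e k m,
      forall f : S -> nat -> bool, exists g : W -> bool,
        forall j, exists K, forall n, (K <= n)%N -> f j n = g (e j n)
    & forall j n, (e j n < \val j)%O].
Proof.
have Sv (j : S) : S (\val j) by exact: set_mem (valP j).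
have /choice[e eP] : forall j : S, exists e : nat -> W,
    {homo e : m n / (m < n)%N >-> (m < n)%O} /\ range e = L (\val j).
  by move=> j; have [_ _ [e e1 e2]] := ladL (Sv j); exists e.
have e_mono j m n : (m < n)%N -> (e j m < e j n)%O by apply: (eP j).1.
have Le j n : L (\val j) (e j n) by rewrite -(eP j).2; exact: imageT.
have e_lt j n : (e j n < \val j)%O.
  by have [Lj _ _] := ladL (Sv j); exact: Lj (Le j n).
have e_inj j : injective (e j).
  move=> m n E; have [/(e_mono j)|/(e_mono j)|//] := ltngtP m n; by rewrite E ltxx.
have e_cofinal j b : (b < \val j)%O ->
    exists N, forall n, (N <= n)%N -> (b <= e j n)%O.
  have [_ cof _] := ladL (Sv j); move=> /cof[c Lc bc].
  have [N _ NE] : range (e j) c by rewrite (eP j).2.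
  exists N => n; rewrite leq_eqVlt => /predU1P[<-|/(e_mono j)/ltW].
    by rewrite NE.
  by rewrite NE; exact: le_trans.
exists e; split=> // [j k jk|f].
  have [jltk|kltj|/val_inj//] := ltgtP (\val j) (\val k); last first.
    have [N hN] := e_cofinal _ _ kltj; exists N => n m /hN kn E.
    by have := lt_le_trans (e_lt k m) kn; rewrite E ltxx.
  have [K hK] := e_cofinal _ _ jltk.
  have [N hN] : exists N, forall (m : 'I_K) n, (N <= n)%N -> e j n <> e k m.
    by apply: uniform_bound => m; exact: injective_avoids.
  exists N => n m Nn; have [mK|/hK jm E] := ltnP m K; first exact: (hN (Ordinal mK)).
  by have := lt_le_trans (e_lt j n) jm; rewrite E ltxx.
have [g gP] := unifL (fun a b =>
  `[< exists (j : S) n, [/\ \val j = a, e j n = b & f j n] >]).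
exists g => j.
have [|N hN] := (finite_nat_bound [set n | f j n <> g (e j n)]).1.
  apply: sub_finite_set
    (finite_preimage (fun m n _ _ => e_inj j m n) (gP _ (Sv j))).
  move=> n /= fg; split; first exact: Le.
  apply: contra_not fg => <-.
  apply/idP/asboolP => [fn|[k [m [/val_inj-> /e_inj->]]]//].
  by exists j, n.
exists N => n Nn; apply: contrapT => /hN; by rewrite ltnNge Nn.
Qed.

End LadderEnumeration.

Theorem theorem4p1 (d : Order.disp_t) (W : orderType d) (hW : is_omega1 W) :
  (exists S : set W, [/\ S `<=` limit_ordinals, stationary S
    & exists2 L : W -> set W, ladder_system S L & uniformizable S L]) ->
  exists (Lg : language) (T : set (sentence Lg)),
    [/\ [set: fun_sym Lg + rel_sym Lg] #= [set: W],
        complete_theory T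
      & exists M : structure Lg,
          [/\ models M T, atomic M,
              forall N : structure Lg, models N T -> atomic N ->
                isomorphic N M,
              prime_model M
            & ~ constructible M]].
Proof.
move=> [S [_ statS [L ladL unifL]]].
have [e [e_inj e_disj e_unif e_lt]] := ladder_enumeration ladL unifL.
have S_inh : inhabited S.
  have [|a [Sa _]] := statS [set: W]; last by exists; exact: exist _ a (mem_set Sa).
  split=> // a; have [b hb] := countable_strict_bound hW (countable1 a).
  by exists b => //; exact: hb.
pose M := ladder_structure e S_inh.
exists (ladder_language W S), (theory M).
split; [exact: ladder_symbols_card|exact: theory_complete|exists M].
split=> //.
- exact: ladder_atomic.
- by move=> N /models_theory NM; exact: ladder_isomorphic.
- by move=> N NM; exact: ladder_elementary_embedding.
move=> /(constructible_injection e_inj e_disj)[h h_inj].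
pose r a := if pselect (S a) is left Sa then
  let j : S := exist _ a (mem_set Sa) in e j (h j) else a.
apply: (@no_injective_regression _ _ hW S r statS) => [a Sa|a b Sa Sb].
  by rewrite /r; case: pselect => // Sa'; exact: e_lt.
rewrite /r; case: pselect => // Sa'; case: pselect => // Sb' /h_inj E.
by have := congr1 val E.
Qed.
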